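(* Let $|q|<1$, let $a,b,c$ be complex numbers, and let $g$ be any function on the nonnegative integers such that both series below converge. Then \[ \sum_{m\geq n\geq 0}\frac{(a;q)_m(b;q)_n(c/b;q)_{m-n}}{(c;q)_m(q;q)_n(a;q)_{m-n}}\left(\frac{c}{ab}\right)^{n}g(m-n) =\frac{(c/a,c/b;q)_{\infty}}{(c,c/ab;q)_{\infty}}\sum_{k=0}^{\infty}g(k). \]
   Context: Notation: $(x;q)_n=(1-x)(1-xq)\cdots(1-xq^{n-1})$, $(x;q)_\infty=\prod_{i\ge0}(1-xq^i)$, $(x_1,\dots,x_r;q)_n=\prod_i(x_i;q)_n$. Parameters are assumed such that no denominator vanishes. *)

(* Defs.v *)
From Stdlib Require Export Reals.
From Coquelicot Require Export Coquelicot.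

Open Scope C_scope.

Fixpoint qpoch (x q : C) (n : nat) : C :=
  match n with
  | O => 1
  | S n' => qpoch x q n' * (1 - x * q ^ n')
  end.

(* The limit of qpoch x q n, taken separately in the real and imaginary parts.
   The limit exists when Cmod q < 1; otherwise the value is meaningless. *)
Definition qpoch_inf (x q : C) : C :=
  (real (Lim_seq (fun n => Re (qpoch x q n))),
   real (Lim_seq (fun n => Im (qpoch x q n)))).

Definition qterm (a b c q : C) (g : nat -> C) (m n : nat) : C :=
  (qpoch a q m * qpoch b q n * qpoch (c / b) q (m - n))
  / (qpoch c q m * qpoch q q n * qpoch a q (m - n))
  * (c / (a * b)) ^ n * g (m - n)%nat.

(* Coquelicot's sum_n u m has the m + 1 terms u 0, ..., u m: the index set
   m >= n >= 0 is exhausted by its finite slices with m fixed.  No absolute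
   convergence is asked for; an absolutely convergent double series converges
   in this sense, to the same sum. *)
Definition is_triangular_series (t : nat -> nat -> C) (s : C) : Prop :=
  is_series (fun m => sum_n (fun n => t m n) m) s.

(* Main.v *)
Require Import Defs.
From Stdlib Require Import Lra Lia Classical FunctionalExtensionality.

(* Put z = c/(ab), h_k = g(k) (c/b)_k/(a)_k and let F be the Cauchy product of h
   with the coefficients of (c x/a)_oo/(z x)_oo; the inner sum over n is
   (a)_m/(c)_m F_m.  For a sequence f let
     T_w(f) = sum_k f_k (a)_k (a w q^k)_oo,
   so that T_(c/a)(F) = (c)_oo S and T_z(h) = (c/b)_oo G.  Writing
   F = (c x/a)_oo U and h = (z x)_oo U as formal power series, the claim is
     (z)_oo T_(c/a)((c x/a)_oo U) = (c/a)_oo T_z((z x)_oo U).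
   Summation by parts gives T_w((1 - w x) K) = (1 - w) T_(wq)(K), with a boundary
   term that vanishes when K_n -> 0.  Iterating it, T_w((w x)_oo U) equals
   (w)_oo sum_k U_k (a)_k whenever U_n -> 0.

   The bound |z| < 1 is not available, so U need not tend to 0.  But F and h do.
   If (z x)_oo and (c x/a)_oo have no common zero in the closed unit disc, this
   forces U_n -> 0; otherwise z and c/a differ by a power of q and finitely many
   summations by parts already connect T_(c/a)(F) with T_z(h). *)

(** * Formal power series and the coefficients of [(B X)_oo / (z X)_oo] *)

Fixpoint conv (f g : nat -> C) (n : nat) : C :=
  match n with
  | O => f O * g O
  | S n' => f O * g (S n') + conv (fun k => f (S k)) g n'
  end.

Definition delta (n : nat) : C := match n with O => 1 | S _ => 0 end.

(** Multiplication of a formal power series by [1 - w X]. *)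
Definition mul_lin (w : C) (f : nat -> C) (n : nat) : C :=
  match n with O => f O | S n' => f (S n') - w * f n' end.

(** The substitution of [q X] for [X] in a formal power series. *)
Definition dilate (q : C) (f : nat -> C) (n : nat) : C := q ^ n * f n.

(* The coefficient of x^n in (B x; q)_oo / (z x; q)_oo. *)
Fixpoint qbin (q B z : C) (n : nat) : C :=
  match n with
  | O => 1
  | S n' => qbin q B z n' * ((z - B * q ^ n') / (1 - q ^ S n'))
  end.

Lemma conv_lin_l (s t : C) (f1 f2 g : nat -> C) (n : nat) :
  conv (fun k => s * f1 k + t * f2 k) g n = s * conv f1 g n + t * conv f2 g n.
Proof.
revert f1 f2; induction n as [|n IH]; intros f1 f2; simpl.
- ring.
- rewrite (IH (fun k => f1 (S k)) (fun k => f2 (S k))); ring.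
Qed.

Lemma conv_S_r (f g : nat -> C) (n : nat) :
  conv f g (S n) = conv f (fun k => g (S k)) n + f (S n) * g O.
Proof.
revert f; induction n as [|n IH]; intros f.
- simpl; ring.
- change (f O * g (S (S n)) + conv (fun k => f (S k)) g (S n) =
          f O * g (S (S n)) + conv (fun k => f (S k)) (fun k => g (S k)) n
          + f (S (S n)) * g O).
  rewrite IH; ring.
Qed.

Lemma conv_comm (f g : nat -> C) : conv f g = conv g f.
Proof.
apply functional_extensionality; intros n; revert f g.
induction n as [|n IH]; intros f g.
- simpl; ring.
- rewrite conv_S_r; simpl; rewrite IH; ring.
Qed.

Lemma conv_assoc (f g h : nat -> C) : conv (conv f g) h = conv f (conv g h).
Proof.
apply functional_extensionality; intros n; revert f.
induction n as [|n IH]; intros f; simpl.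
- ring.
- replace (fun k => f O * g (S k) + conv (fun k => f (S k)) g k)
    with (fun k => f O * g (S k) + 1 * conv (fun k => f (S k)) g k)
    by (apply functional_extensionality; intros; ring).
  rewrite (conv_lin_l (f O) 1 (fun k => g (S k))), IH; ring.
Qed.

Lemma conv_0_l (f : nat -> C) (n : nat) : conv (fun _ => 0) f n = 0.
Proof. induction n as [|n IH]; simpl; [ring | rewrite IH; ring]. Qed.

Lemma conv_delta_l (f : nat -> C) : conv delta f = f.
Proof.
apply functional_extensionality; intros [|n]; simpl; [ring |].
rewrite conv_0_l; ring.
Qed.

Lemma conv_sum (f g : nat -> C) (n : nat) :
  sum_n (fun k => f k * g (n - k)%nat) n = conv f g n.
Proof.
unfold sum_n; revert f; induction n as [|n IH]; intros f.
- rewrite sum_n_n; reflexivity.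
- rewrite sum_Sn_m by lia; simpl conv; rewrite <- IH, <- sum_n_m_S.
  reflexivity.
Qed.

(** [mul_lin w] is itself convolution with the coefficients of [1 - w X], so associativity gives the
    claim. *)
Lemma mul_lin_conv (w : C) (f g : nat -> C) :
  mul_lin w (conv f g) = conv (mul_lin w f) g.
Proof.
assert (H : forall h, mul_lin w h
  = conv (fun n => match n with O => 1 | 1%nat => - w | _ => 0 end) h).
{ intros h; apply functional_extensionality; intros [|n]; simpl; [ring|].
  destruct n as [|n]; simpl; [ring | rewrite conv_0_l; ring]. }
now rewrite !H, conv_assoc.
Qed.

Lemma mul_lin_0 (f : nat -> C) : mul_lin 0 f = f.
Proof. apply functional_extensionality; intros [|n]; simpl; ring. Qed.

Lemma dilate_conv (q : C) (f g : nat -> C) :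
  dilate q (conv f g) = conv (dilate q f) (dilate q g).
Proof.
apply functional_extensionality; intros n; unfold dilate; revert f.
induction n as [|n IH]; intros f; simpl; [ring|].
replace (fun k => q * q ^ k * f (S k)) with (fun k => q ^ k * (q * f (S k)))
  by (apply functional_extensionality; intros; ring).
rewrite <- (IH (fun k => q * f (S k))).
replace (fun k => q * f (S k)) with (fun k => q * f (S k) + 0 * f k)
  by (apply functional_extensionality; intros; ring).
rewrite (conv_lin_l q 0 (fun k => f (S k)) f); ring.
Qed.

Lemma one_minus_qpow_neq0 (q : C) (n : nat) : (Cmod q < 1)%R -> 1 - q ^ S n <> 0.
Proof.
intros Hq H.
assert (E : q ^ S n = 1).
{ replace (q ^ S n) with (1 - (1 - q ^ S n)) by ring; rewrite H; ring. }
assert (M : (Cmod (q ^ S n) = 1)%R) by (rewrite E; apply Cmod_1).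
rewrite Cmod_pow in M.
destruct (pow_lt_1_compat (Cmod q) (S n)) as [_ L];
  [split; [apply Cmod_ge_0 | exact Hq] | lia |].
lra.
Qed.

(** Read coefficientwise, [(1 - z X) f(X) = (1 - B X) f(q X)] is the recursion defining [qbin]. *)
Lemma qbin_functional (q B z : C) : (Cmod q < 1)%R ->
  mul_lin z (qbin q B z) = mul_lin B (dilate q (qbin q B z)).
Proof.
intros Hq; apply functional_extensionality; intros [|n].
- simpl; unfold dilate; simpl; ring.
- pose proof (one_minus_qpow_neq0 q n Hq) as H.
  unfold mul_lin, dilate; simpl in *; field; exact H.
Qed.

(** The coefficient of degree [n + 1] in the equation determines [f (n + 1)] from [f n], because
    [1 - q^(n+1)] is nonzero for [|q| < 1]. *)
Lemma qbin_unique (q B z : C) (f : nat -> C) : (Cmod q < 1)%R ->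
  f O = 1 -> mul_lin z f = mul_lin B (dilate q f) -> f = qbin q B z.
Proof.
intros Hq H0 Hf; apply functional_extensionality; intros n.
induction n as [|n IH]; [exact H0|].
pose proof (one_minus_qpow_neq0 q n Hq) as H.
assert (E := f_equal (fun h => h (S n)) Hf); unfold mul_lin, dilate in E.
assert (E' : f (S n) * (1 - q ^ S n) = f n * (z - B * q ^ n)).
{ transitivity (f (S n) - z * f n + z * f n - q ^ S n * f (S n)); [ring|].
  rewrite E; ring. }
change (f (S n) = qbin q B z n * ((z - B * q ^ n) / (1 - q ^ S n))).
rewrite <- IH.
replace (f n * ((z - B * q ^ n) / (1 - q ^ S n)))
  with (f n * (z - B * q ^ n) / (1 - q ^ S n)) by (field; exact H).
rewrite <- E'; field; exact H.
Qed.

(** The infinite products cancel like fractions: using the functional equation of each factor in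
    turn, the product is seen to satisfy the one that characterises [qbin q x z]. *)
Lemma qbin_conv (q x y z : C) : (Cmod q < 1)%R ->
  conv (qbin q x y) (qbin q y z) = qbin q x z.
Proof.
intros Hq; apply qbin_unique; [exact Hq | simpl; ring |].
rewrite dilate_conv.
rewrite (mul_lin_conv x), <- qbin_functional by exact Hq.
rewrite <- mul_lin_conv, conv_comm, mul_lin_conv, qbin_functional by exact Hq.
now rewrite <- mul_lin_conv, conv_comm.
Qed.

Lemma qbin_diag (q z : C) : (Cmod q < 1)%R -> qbin q z z = delta.
Proof.
intros Hq; symmetry; apply qbin_unique; [exact Hq | reflexivity |].
apply f_equal, functional_extensionality; intros [|n]; unfold dilate, delta; simpl; ring.
Qed.

Lemma qbin_scale (q w y : C) (n : nat) :
  qbin q (w * y) 0 n = y ^ n * qbin q w 0 n.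
Proof.
induction n as [|n IH]; simpl; [ring|]. rewrite IH; unfold Cdiv; ring.
Qed.

(** At [z = 0] the functional equation reads [f(X) = (1 - w X) f(q X)], and [f(q X)] is
    [(w q X)_oo]. *)
Lemma qbin_peel (q w : C) : (Cmod q < 1)%R ->
  qbin q w 0 = mul_lin w (qbin q (w * q) 0).
Proof.
intros Hq.
replace (qbin q (w * q) 0) with (dilate q (qbin q w 0)).
- now rewrite <- qbin_functional, mul_lin_0.
- apply functional_extensionality; intros n; now rewrite qbin_scale.
Qed.

(** * Null sequences and limits of complex sequences *)

Definition null (u : nat -> C) : Prop := is_lim_seq (fun n => Cmod (u n)) 0%R.

Definition tends (u : nat -> C) (l : C) : Prop := null (fun n => u n - l).

Lemma lim0_scal (K : R) (v : nat -> R) :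
  is_lim_seq v 0%R -> is_lim_seq (fun n => (K * v n)%R) 0%R.
Proof.
intros H; replace 0%R with (K * 0)%R by ring.
exact (is_lim_seq_scal_l v K 0%R H).
Qed.

Lemma lim0_geom (r : R) : (0 <= r < 1)%R -> is_lim_seq (fun n => (r ^ n)%R) 0%R.
Proof. intros Hr; apply is_lim_seq_geom; rewrite Rabs_pos_eq; lra. Qed.

Lemma null_le (u : nat -> C) (v : nat -> R) :
  (forall n, (Cmod (u n) <= v n)%R) -> is_lim_seq v 0%R -> null u.
Proof.
intros H Hv; apply (is_lim_seq_le_le (fun _ => 0%R) _ v); [| apply is_lim_seq_const | exact Hv].
intros n; split; [apply Cmod_ge_0 | apply H].
Qed.

Lemma null_ext (u v : nat -> C) : (forall n, u n = v n) -> null u -> null v.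
Proof. intros H; apply is_lim_seq_ext; intros n; now rewrite H. Qed.

Lemma null_plus (u v : nat -> C) : null u -> null v -> null (fun n => u n + v n).
Proof.
intros Hu Hv; apply (null_le _ (fun n => (Cmod (u n) + Cmod (v n))%R)).
- intros n; apply Cmod_triangle.
- replace 0%R with (0 + 0)%R by ring; now apply is_lim_seq_plus'.
Qed.

Lemma null_bounded_mult (K : R) (c u : nat -> C) :
  (forall n, (Cmod (c n) <= K)%R) -> null u -> null (fun n => c n * u n).
Proof.
intros Hc Hu; apply (null_le _ (fun n => (K * Cmod (u n))%R)).
- intros n; rewrite Cmod_mult; apply Rmult_le_compat_r; [apply Cmod_ge_0 | apply Hc].
- now apply lim0_scal.
Qed.

Lemma null_scal (c : C) (u : nat -> C) : null u -> null (fun n => c * u n).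
Proof. apply (null_bounded_mult (Cmod c)); intros _; apply Rle_refl. Qed.

Lemma null_minus (u v : nat -> C) : null u -> null v -> null (fun n => u n - v n).
Proof.
intros Hu Hv; apply (null_ext (fun n => u n + (-1) * v n)); [intros; ring |].
now apply null_plus, null_scal.
Qed.

Lemma null_incr (u : nat -> C) : null u <-> null (fun n => u (S n)).
Proof. apply (is_lim_seq_incr_1 (fun n => Cmod (u n))). Qed.

Lemma null_const (c : C) : null (fun _ => c) -> c = 0.
Proof.
intros H; apply Cmod_eq_0.
assert (E : Lim_seq (fun _ => Cmod c) = Finite 0%R) by exact (is_lim_seq_unique _ _ H).
rewrite Lim_seq_const in E.
now injection E.
Qed.

Lemma bounded_of_eventually (f : nat -> R) (N : nat) (K : R) :
  (forall n, (N <= n)%nat -> (f n <= K)%R) ->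
  exists K', forall n, (f n <= K')%R.
Proof.
revert K; induction N as [|N IH]; intros K H.
- exists K; intros n; apply H; lia.
- apply (IH (Rmax K (f N))); intros n Hn.
  destruct (Nat.eq_dec n N) as [->|D]; [apply Rmax_r |].
  apply Rle_trans with K; [apply H; lia | apply Rmax_l].
Qed.

Lemma bounded_of_lim (f : nat -> R) (l : R) :
  is_lim_seq f l -> exists K, forall n, (f n <= K)%R.
Proof.
intros H; apply is_lim_seq_spec in H.
destruct (H (mkposreal 1 Rlt_0_1)) as [N HN]; simpl in HN.
apply (bounded_of_eventually f N (l + 1)); intros n Hn.
apply HN, Rabs_def2 in Hn; lra.
Qed.

Lemma tends_unique (u : nat -> C) (l l' : C) : tends u l -> tends u l' -> l = l'.
Proof.
intros H H'.
assert (E : l' - l = 0).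
{ apply null_const, (null_ext (fun n => (u n - l) - (u n - l'))); [intros; ring |].
  now apply null_minus. }
replace l' with (l' - l + l) by ring; rewrite E; ring.
Qed.

Lemma tends_bounded (u : nat -> C) (l : C) :
  tends u l -> exists K, forall n, (Cmod (u n) <= K)%R.
Proof.
intros H; destruct (bounded_of_lim _ _ H) as [K HK]; exists (K + Cmod l)%R; intros n.
replace (u n) with (u n - l + l) by ring.
apply Rle_trans with (1 := Cmod_triangle _ _); specialize (HK n); lra.
Qed.

Lemma tends_const (c : C) : tends (fun _ => c) c.
Proof.
apply (null_le _ (fun _ => 0%R)); [| apply is_lim_seq_const].
intros n; replace (c - c) with (RtoC 0) by ring; rewrite Cmod_0; apply Rle_refl.
Qed.

Lemma tends_plus (u v : nat -> C) (l m : C) :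
  tends u l -> tends v m -> tends (fun n => u n + v n) (l + m).
Proof.
intros Hu Hv; apply (null_ext (fun n => (u n - l) + (v n - m))); [intros; ring |].
now apply null_plus.
Qed.

Lemma tends_mult (u v : nat -> C) (l m : C) :
  tends u l -> tends v m -> tends (fun n => u n * v n) (l * m).
Proof.
intros Hu Hv; destruct (tends_bounded _ _ Hu) as [K HK].
apply (null_ext (fun n => u n * (v n - m) + m * (u n - l))); [intros; ring |].
apply null_plus; [now apply (null_bounded_mult K) | now apply null_scal].
Qed.

Lemma tends_sum (u : nat -> nat -> C) (l : nat -> C) (M : nat) :
  (forall k, tends (fun n => u n k) (l k)) ->
  tends (fun n => sum_n (u n) M) (sum_n l M).
Proof.
intros H; induction M as [|M IH].
- apply (null_ext (fun n => u n O - l O)); [intros; now rewrite !sum_O | apply H].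
- apply (null_ext (fun n => (sum_n (u n) M + u n (S M)) - (sum_n l M + l (S M)))).
  + intros; now rewrite !sum_Sn.
  + apply (tends_plus (fun n => sum_n (u n) M)); [exact IH | apply H].
Qed.

Lemma Cmod_le_of_tends (u : nat -> C) (l : C) (K : R) :
  (forall n, (Cmod (u n) <= K)%R) -> tends u l -> (Cmod l <= K)%R.
Proof.
intros H Hl.
assert (E := is_lim_seq_plus' _ _ K 0%R (is_lim_seq_const K) Hl).
rewrite Rplus_0_r in E.
apply (is_lim_seq_le (fun _ => Cmod l) _ (Cmod l) K) in E;
  [exact E | | apply is_lim_seq_const].
intros n; replace l with (u n + - (u n - l)) at 1 by ring.
apply Rle_trans with (1 := Cmod_triangle _ _); rewrite Cmod_opp.
specialize (H n); lra.
Qed.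

Lemma tends_of_is_series (f : nat -> C) (s : C) : is_series f s -> tends (sum_n f) s.
Proof.
intros H; apply is_lim_seq_spec; intros eps; unfold is_series in H.
(* The norm of [C] as a normed module is [Cmod], which turns the filter limit into a real one. *)
assert (L := proj1 (filterlim_locally_ball_norm _ _) H eps).
revert L; apply filter_imp; intros n Hn.
rewrite Rminus_0_r, Rabs_pos_eq by apply Cmod_ge_0; exact Hn.
Qed.

Lemma null_of_is_series (f : nat -> C) (s : C) : is_series f s -> null f.
Proof.
intros H; apply tends_of_is_series in H; apply null_incr.
apply (null_ext (fun n => (sum_n f (S n) - s) - (sum_n f n - s))).
- intros n; rewrite sum_Sn; change plus with Cplus; ring.
- apply null_minus; [exact (proj1 (null_incr _) H) | exact H].
Qed.

(** * Geometric decay and convolution with null sequences *)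

Lemma lim0_contraction (r : R) (s e : nat -> R) :
  (0 <= r < 1)%R -> (forall n, (0 <= s n)%R) ->
  (forall n, (s (S n) <= r * s n + e n)%R) ->
  is_lim_seq e 0%R -> is_lim_seq s 0%R.
Proof.
intros Hr Hs Hrec He; apply is_lim_seq_spec; intros eps.
(* The tolerance for [e] is chosen so that [eps / 2] is the fixed point of
   [s -> r s + eps / 2 * (1 - r)]. *)
assert (Hd : (0 < eps / 2 * (1 - r))%R)
  by (apply Rmult_lt_0_compat; [destruct eps; simpl; lra | lra]).
apply is_lim_seq_spec in He; destruct (He (mkposreal _ Hd)) as [N HN]; simpl in HN.
assert (B : forall k, (s (k + N)%nat <= r ^ k * s N + eps / 2)%R).
{ induction k as [|k IH]; simpl.
  - destruct eps; simpl; lra.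
  - apply Rle_trans with (1 := Hrec _).
    assert (L : (e (k + N)%nat <= eps / 2 * (1 - r))%R)
      by (assert (L := HN (k + N)%nat ltac:(lia)); apply Rabs_def2 in L; lra).
    apply (Rmult_le_compat_l r) in IH; [lra | lra]. }
assert (G : is_lim_seq (fun k => (r ^ k * s N)%R) 0%R).
{ apply (is_lim_seq_ext (fun k => (s N * r ^ k)%R)); [intros; ring |].
  now apply lim0_scal, lim0_geom. }
apply is_lim_seq_spec in G.
destruct (G (mkposreal (eps / 2) ltac:(destruct eps; simpl; lra))) as [N' HN']; simpl in HN'.
exists (N' + N)%nat; intros n Hn.
replace n with ((n - N) + N)%nat by lia.
specialize (B (n - N)%nat); specialize (HN' (n - N)%nat ltac:(lia)).
apply Rabs_def2 in HN'; specialize (Hs ((n - N) + N)%nat).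
apply Rabs_def1; lra.
Qed.

(** As [l < r], the quotient [f n / r^n] is eventually nonincreasing, hence bounded. *)
Lemma geometric_of_ratio (f rho : nat -> R) (l r : R) :
  (0 < r)%R -> (l < r)%R -> (forall n, (0 <= f n)%R) ->
  (forall n, (f (S n) <= rho n * f n)%R) -> is_lim_seq rho l ->
  exists K, forall n, (f n <= K * r ^ n)%R.
Proof.
intros Hr Hl Hf Hrec Hrho; apply is_lim_seq_spec in Hrho.
destruct (Hrho (mkposreal (r - l) ltac:(lra))) as [N HN]; simpl in HN.
assert (Hp : forall n, (0 < r ^ n)%R) by (intros; now apply pow_lt).
destruct (bounded_of_eventually (fun n => f n / r ^ n)%R N (f N / r ^ N)%R) as [K HK].
- intros n Hn; induction Hn as [|n Hn IH]; [apply Rle_refl |].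
  apply Rle_trans with (2 := IH).
  apply (Rmult_le_reg_r (r ^ S n)); [apply Hp |].
  unfold Rdiv; rewrite Rmult_assoc, Rinv_l, Rmult_1_r by (apply Rgt_not_eq, Hp).
  replace (f n * / r ^ n * r ^ S n)%R with (r * f n)%R
    by (simpl; field; apply Rgt_not_eq, Hp).
  apply Rle_trans with (1 := Hrec n), Rmult_le_compat_r; [apply Hf |].
  specialize (HN n Hn); apply Rabs_def2 in HN; lra.
- exists K; intros n; apply (Rmult_le_reg_r (/ r ^ n)); [apply Rinv_0_lt_compat, Hp |].
  rewrite Rmult_assoc, Rinv_r, Rmult_1_r by (apply Rgt_not_eq, Hp); apply HK.
Qed.

(** The sum of [r^(n-k) |u_k|] over [k <= n], in the recursive form to which [lim0_contraction]
    applies. *)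
Fixpoint geom_conv (r : R) (u : nat -> C) (n : nat) : R :=
  match n with
  | O => Cmod (u O)
  | S n' => Cmod (u n) + r * geom_conv r u n'
  end.

Lemma geom_conv_bound (r K : R) (f u : nat -> C) :
  (forall n, (Cmod (f n) <= K * r ^ n)%R) ->
  forall n, (Cmod (conv f u n) <= K * geom_conv r u n)%R.
Proof.
intros Hf n; revert f K Hf; induction n as [|n IH]; intros f K Hf; simpl.
- rewrite Cmod_mult; apply Rmult_le_compat_r; [apply Cmod_ge_0 |].
  specialize (Hf O); simpl in Hf; lra.
- apply Rle_trans with (1 := Cmod_triangle _ _).
  rewrite Rmult_plus_distr_l; apply Rplus_le_compat.
  + rewrite Cmod_mult; apply Rmult_le_compat_r; [apply Cmod_ge_0 |].
    specialize (Hf O); simpl in Hf; lra.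
  (* The shifted [f] satisfies the same bound with [K * r] in place of [K]. *)
  + rewrite <- Rmult_assoc; apply IH; intros k.
    apply Rle_trans with (1 := Hf (S k)); simpl; lra.
Qed.

Lemma geom_conv_lim (r : R) (u : nat -> C) :
  (0 <= r < 1)%R -> null u -> is_lim_seq (geom_conv r u) 0%R.
Proof.
intros Hr Hu.
assert (P : forall n, (0 <= geom_conv r u n)%R).
{ induction n as [|n IH]; simpl; [apply Cmod_ge_0 |].
  apply Rplus_le_le_0_compat; [apply Cmod_ge_0 | apply Rmult_le_pos; lra]. }
apply (lim0_contraction r _ (fun n => Cmod (u (S n)))); [exact Hr | exact P | |].
- intros n; simpl; lra.
- exact (proj1 (null_incr u) Hu).
Qed.

Lemma null_conv (r K : R) (f u : nat -> C) : (0 <= r < 1)%R ->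
  (forall n, (Cmod (f n) <= K * r ^ n)%R) -> null u -> null (conv f u).
Proof.
intros Hr Hf Hu; apply (null_le _ (fun n => (K * geom_conv r u n)%R)).
- now apply geom_conv_bound.
- now apply lim0_scal, geom_conv_lim.
Qed.

Lemma null_mul_lin (w : C) (u : nat -> C) : null u -> null (mul_lin w u).
Proof.
intros Hu; apply null_incr; simpl.
apply null_minus; [exact (proj1 (null_incr u) Hu) | now apply null_scal].
Qed.

(** [u (n + 1)] is [w u n] plus a null term, which is a contraction. *)
Lemma null_mul_lin_small (w : C) (u : nat -> C) :
  (Cmod w < 1)%R -> null (mul_lin w u) -> null u.
Proof.
intros Hw Hu.
apply (lim0_contraction (Cmod w) _ (fun n => Cmod (mul_lin w u (S n)))).
- split; [apply Cmod_ge_0 | exact Hw].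
- intros; apply Cmod_ge_0.
- intros n; simpl; rewrite <- Cmod_mult, Rplus_comm.
  replace (u (S n)) with (u (S n) - w * u n + w * u n) at 1 by ring.
  apply Cmod_triangle.
- exact (proj1 (null_incr _) Hu).
Qed.

(** This is the Bezout identity [w (1 - v X) - v (1 - w X) = w - v] for two distinct linear
    factors. *)
Lemma null_mul_lin_two (v w : C) (u : nat -> C) :
  v <> w -> null (mul_lin v u) -> null (mul_lin w u) -> null u.
Proof.
intros D Hv Hw; apply null_incr.
assert (D' : w - v <> 0) by (intros E; apply D; replace w with (w - v + v) by ring;
  rewrite E; ring).
apply (null_ext (fun n => / (w - v) *
   (w * mul_lin v u (S n) - v * mul_lin w u (S n)))).
- intros n; simpl; field; exact D'.
- apply null_scal, null_minus; apply null_scal.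
  + exact (proj1 (null_incr _) Hv).
  + exact (proj1 (null_incr _) Hw).
Qed.

(** The ratio of consecutive coefficients is bounded by a sequence tending to [|z|], so every
    [r > |z|] serves. *)
Lemma qbin_geometric (q B z : C) (r : R) : (Cmod q < 1)%R ->
  (0 < r)%R -> (Cmod z < r)%R ->
  exists K, forall n, (Cmod (qbin q B z n) <= K * r ^ n)%R.
Proof.
intros Hq Hr Hz; pose proof (Cmod_ge_0 q) as Hq0.
assert (G : is_lim_seq (fun n => (Cmod q ^ n)%R) 0%R)
  by now apply lim0_geom.
apply (geometric_of_ratio _
  (fun n => ((Cmod z + Cmod B * Cmod q ^ n) / (1 - Cmod q ^ S n))%R) (Cmod z));
  [exact Hr | exact Hz | intros; apply Cmod_ge_0 | |].
- intros n; change (qbin q B z (S n)) with (qbin q B z n * ((z - B * q ^ n) / (1 - q ^ S n))).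
  pose proof (one_minus_qpow_neq0 q n Hq) as H.
  destruct (pow_lt_1_compat (Cmod q) (S n) (conj Hq0 Hq)) as [_ L]; [lia |].
  assert (L2 : (1 - Cmod q ^ S n <= Cmod (1 - q ^ S n))%R).
  { pose proof (Cmod_triangle (1 - q ^ S n) (q ^ S n)) as T.
    replace (1 - q ^ S n + q ^ S n) with (RtoC 1) in T by ring.
    rewrite Cmod_1, Cmod_pow in T; lra. }
  rewrite Cmod_mult, Rmult_comm; apply Rmult_le_compat_r; [apply Cmod_ge_0 |].
  rewrite Cmod_div by exact H; apply Rmult_le_compat.
  + apply Cmod_ge_0.
  + apply Rlt_le, Rinv_0_lt_compat; lra.
  + apply Rle_trans with (1 := Cmod_triangle _ _).
    rewrite Cmod_opp, Cmod_mult, Cmod_pow; apply Rle_refl.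
  + apply Rinv_le_contravar; lra.
- assert (E : ((Cmod z + 0) / (1 - 0))%R = Cmod z) by field.
  refine (eq_ind _ (fun l : R => is_lim_seq _ l) _ _ E); clear E.
  apply is_lim_seq_div'; [| | apply Rgt_not_eq; lra].
  + apply is_lim_seq_plus'; [apply is_lim_seq_const |].
    now apply (lim0_scal (Cmod B)).
  + apply is_lim_seq_minus'; [apply is_lim_seq_const |].
    now apply (is_lim_seq_incr_1 (fun n => (Cmod q ^ n)%R)).
Qed.

Lemma null_conv_qbin (q B z : C) (u : nat -> C) : (Cmod q < 1)%R ->
  (Cmod z < 1)%R -> null u -> null (conv (qbin q B z) u).
Proof.
intros Hq Hz Hu.
(* The midpoint of [|z|] and 1 stays positive even when [z = 0]. *)
destruct (qbin_geometric q B z ((Cmod z + 1) / 2)) as [K HK];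
  [exact Hq | pose proof (Cmod_ge_0 z); lra | lra |].
apply (null_conv ((Cmod z + 1) / 2) K); [pose proof (Cmod_ge_0 z); lra | exact HK | exact Hu].
Qed.

(** * Convergence and nonvanishing of the infinite products *)

Lemma qpoch_split (x q : C) (k n : nat) :
  qpoch x q (k + n) = qpoch x q k * qpoch (x * q ^ k) q n.
Proof.
induction n as [|n IH].
- rewrite Nat.add_0_r; simpl; ring.
- rewrite Nat.add_succ_r; simpl; rewrite IH, Cpow_add_r; ring.
Qed.

(** [Lim_seq] always has a value; summable increments make the sequence converge to it. *)
Lemma Lim_seq_of_geometric (v : nat -> R) (K r : R) : (0 <= r < 1)%R ->
  (forall n, (Rabs (v (S n) - v n) <= K * r ^ n)%R) ->
  is_lim_seq v (real (Lim_seq v)).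
Proof.
intros Hr Hv; apply Lim_seq_correct'.
destruct (ex_series_le (fun n => (v (S n) - v n)%R) (fun n => (K * r ^ n)%R)) as [l Hl].
- exact Hv.
- apply (ex_series_scal_l K (fun n => (r ^ n)%R)), ex_series_geom; rewrite Rabs_pos_eq; lra.
- exists (v O + l)%R; apply is_lim_seq_incr_1.
  apply (is_lim_seq_ext (fun n => (v O + sum_n (fun n => (v (S n) - v n)%R) n)%R)).
  + induction n as [|n IH]; [rewrite sum_O; ring |].
    rewrite sum_Sn; change plus with Rplus; rewrite <- Rplus_assoc, IH; ring.
  + apply is_lim_seq_plus'; [apply is_lim_seq_const | exact Hl].
Qed.

Lemma Cmod_le_Re_Im (x : C) : (Cmod x <= Rabs (Re x) + Rabs (Im x))%R.
Proof.
replace x with (RtoC (Re x) + Ci * RtoC (Im x)) at 1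
  by (destruct x; unfold Cplus, Cmult, Ci, RtoC; simpl; f_equal; ring).
apply Rle_trans with (1 := Cmod_triangle _ _).
rewrite Cmod_mult, !Cmod_R.
replace (Cmod Ci) with 1%R; [lra |].
unfold Cmod, Ci; simpl; rewrite <- sqrt_1 at 1; f_equal; ring.
Qed.

Lemma tends_Lim_seq (u : nat -> C) (K r : R) : (0 <= r < 1)%R ->
  (forall n, (Cmod (u (S n) - u n) <= K * r ^ n)%R) ->
  tends u (real (Lim_seq (fun n => Re (u n))), real (Lim_seq (fun n => Im (u n)))).
Proof.
intros Hr Hu.
assert (HR := Lim_seq_of_geometric (fun n => Re (u n)) K r Hr).
assert (HI := Lim_seq_of_geometric (fun n => Im (u n)) K r Hr).
set (lr := real (Lim_seq (fun n => Re (u n)))) in *.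
set (li := real (Lim_seq (fun n => Im (u n)))) in *.
apply (null_le _ (fun n => (Rabs (Re (u n) - lr) + Rabs (Im (u n) - li))%R)).
- intros n; exact (Cmod_le_Re_Im (u n - (lr, li))).
- replace 0%R with (Rabs (lr - lr) + Rabs (li - li))%R
    by (unfold Rminus; rewrite !Rplus_opp_r, Rabs_R0; ring).
  apply is_lim_seq_plus'.
  + apply (is_lim_seq_abs _ (lr - lr)%R).
    apply is_lim_seq_minus'; [apply HR | apply is_lim_seq_const].
    intros n; exact (Rle_trans _ _ _ (re_le_Cmod (u (S n) - u n)) (Hu n)).
  + apply (is_lim_seq_abs _ (li - li)%R).
    apply is_lim_seq_minus'; [apply HI | apply is_lim_seq_const].
    intros n; refine (Rle_trans _ _ _ _ (Hu n)).
    exact (Rle_trans _ _ _ (Rmax_r _ _) (Rmax_Cmod (u (S n) - u n))).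
Qed.

(** Consecutive increments of the partial products differ by the factor [q (1 - x q^n)], whose
    modulus tends to [|q| < 1]; the increments therefore decay geometrically. *)
Lemma tends_qpoch (x q : C) : (Cmod q < 1)%R -> tends (qpoch x q) (qpoch_inf x q).
Proof.
intros Hq.
pose proof (Cmod_ge_0 q) as Hq0.
destruct (geometric_of_ratio (fun n => Cmod (qpoch x q (S n) - qpoch x q n))
  (fun n => (Cmod q * (1 + Cmod x * Cmod q ^ n))%R) (Cmod q) ((Cmod q + 1) / 2))
  as [K HK]; [lra | lra | intros; apply Cmod_ge_0 | | |].
- intros n.
  replace (qpoch x q (S (S n)) - qpoch x q (S n))
    with (q * (1 - x * q ^ n) * (qpoch x q (S n) - qpoch x q n)) by (simpl; ring).
  rewrite !Cmod_mult; apply Rmult_le_compat_r; [apply Cmod_ge_0 |].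
  apply Rmult_le_compat_l; [exact Hq0 |].
  apply Rle_trans with (1 := Cmod_triangle _ _).
  rewrite Cmod_opp, Cmod_mult, Cmod_pow, Cmod_1; apply Rle_refl.
- apply (is_lim_seq_ext (fun n => (Cmod q + Cmod q * Cmod x * Cmod q ^ n)%R));
    [intros; ring |].
  pose proof (is_lim_seq_plus' _ _ _ _ (is_lim_seq_const (Cmod q))
    (lim0_scal (Cmod q * Cmod x) _ (lim0_geom (Cmod q) (conj Hq0 Hq)))) as L.
  rewrite Rplus_0_r in L; exact L.
- apply (tends_Lim_seq _ K ((Cmod q + 1) / 2)); [lra | exact HK].
Qed.

Lemma qpoch_inf_split (x q : C) (k : nat) : (Cmod q < 1)%R ->
  qpoch_inf x q = qpoch x q k * qpoch_inf (x * q ^ k) q.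
Proof.
intros Hq; apply (tends_unique (fun n => qpoch x q (k + n))).
- assert (H := tends_qpoch x q Hq).
  apply (is_lim_seq_incr_n _ k) in H.
  revert H; apply is_lim_seq_ext; intros n; now rewrite Nat.add_comm.
- apply (null_ext (fun n => qpoch x q k * qpoch (x * q ^ k) q n
    - qpoch x q k * qpoch_inf (x * q ^ k) q)).
  + intros n; now rewrite qpoch_split.
  + now apply tends_mult; [apply tends_const | apply tends_qpoch].
Qed.

(** The bound is the sum of [2 |y| |q|^i] over [i < n]. The smallness of [y] keeps it at most 1, so
    the partial products have modulus at most 2 and the induction closes. *)
Lemma qpoch_near_1 (y q : C) (n : nat) : (Cmod q < 1)%R ->
  (Cmod y <= (1 - Cmod q) / 2)%R ->
  (Cmod (qpoch y q n - 1) <= 2 * Cmod y / (1 - Cmod q) * (1 - Cmod q ^ n))%R.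
Proof.
intros Hq Hy; pose proof (Cmod_ge_0 q) as Hq0; pose proof (Cmod_ge_0 y) as Hy0.
assert (L : (0 <= 2 * Cmod y / (1 - Cmod q) <= 1)%R).
{ split.
  - apply Rmult_le_pos; [lra | apply Rlt_le, Rinv_0_lt_compat; lra].
  - apply (Rmult_le_reg_r (1 - Cmod q)); [lra |].
    unfold Rdiv; rewrite Rmult_assoc, Rinv_l by lra; lra. }
induction n as [|n IH].
- simpl; replace (1 - 1) with (RtoC 0) by ring; rewrite Cmod_0; lra.
- assert (P : (0 <= Cmod q ^ n <= 1)%R).
  { split; [now apply pow_le |]; rewrite <- (pow1 n); apply pow_incr; lra. }
  assert (B : (Cmod (qpoch y q n) <= 2)%R).
  { replace (qpoch y q n) with (qpoch y q n - 1 + 1) by ring.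
    apply Rle_trans with (1 := Cmod_triangle _ _); rewrite Cmod_1.
    assert (2 * Cmod y / (1 - Cmod q) * (1 - Cmod q ^ n) <= 1 * 1)%R
      by (apply Rmult_le_compat; lra).
    lra. }
  replace (qpoch y q (S n) - 1)
    with (qpoch y q n - 1 + - (y * q ^ n * qpoch y q n)) by (simpl; ring).
  apply Rle_trans with (1 := Cmod_triangle _ _).
  rewrite Cmod_opp, !Cmod_mult, Cmod_pow.
  replace (2 * Cmod y / (1 - Cmod q) * (1 - Cmod q ^ S n))%R with
    (2 * Cmod y / (1 - Cmod q) * (1 - Cmod q ^ n) + Cmod y * Cmod q ^ n * 2)%R
    by (simpl; field; lra).
  apply Rplus_le_compat; [exact IH |].
  apply Rmult_le_compat_l; [apply Rmult_le_pos; lra | exact B].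
Qed.

Lemma tends_qpoch_inf_tail (x q : C) : (Cmod q < 1)%R ->
  tends (fun n => qpoch_inf (x * q ^ n) q) 1.
Proof.
intros Hq; pose proof (Cmod_ge_0 q) as Hq0.
assert (G : is_lim_seq (fun n => Cmod (x * q ^ n)) 0%R).
{ apply (is_lim_seq_ext (fun n => (Cmod x * Cmod q ^ n)%R)).
  - intros n; now rewrite Cmod_mult, Cmod_pow.
  - now apply lim0_scal, lim0_geom. }
assert (G2 := lim0_scal (2 / (1 - Cmod q)) _ G).
refine (is_lim_seq_le_le_loc (fun _ => 0%R) _ _ _ _ (is_lim_seq_const 0%R) G2).
apply is_lim_seq_spec in G.
destruct (G (mkposreal ((1 - Cmod q) / 2) ltac:(lra))) as [N HN]; simpl in HN.
exists N; intros n Hn; split; [apply Cmod_ge_0 |].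
specialize (HN n Hn); apply Rabs_def2 in HN.
(* The estimate for finite products is uniform in [m], so it passes to the infinite product. *)
apply (Cmod_le_of_tends (fun m => qpoch (x * q ^ n) q m - 1)).
- intros m; apply Rle_trans with (1 := qpoch_near_1 (x * q ^ n) q m Hq ltac:(lra)).
  assert (P : (0 <= Cmod q ^ m)%R) by now apply pow_le.
  assert (L : (0 <= 2 * Cmod (x * q ^ n) / (1 - Cmod q))%R).
  { apply Rmult_le_pos; [pose proof (Cmod_ge_0 (x * q ^ n)); lra |].
    apply Rlt_le, Rinv_0_lt_compat; lra. }
  replace (2 / (1 - Cmod q) * Cmod (x * q ^ n))%R
    with (2 * Cmod (x * q ^ n) / (1 - Cmod q) * 1)%R by (unfold Rdiv; ring).
  apply Rmult_le_compat_l; lra.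
- apply (null_ext (fun m => qpoch (x * q ^ n) q m - qpoch_inf (x * q ^ n) q));
    [intros; ring | now apply tends_qpoch].
Qed.

(** If the product were 0, every tail [(x q^n)_oo] would be 0 as well, whereas the tails tend to
    1. *)
Lemma qpoch_inf_neq0 (x q : C) : (Cmod q < 1)%R ->
  (forall k, qpoch x q k <> 0) -> qpoch_inf x q <> 0.
Proof.
intros Hq Hx E.
assert (T := tends_qpoch_inf_tail x q Hq).
assert (Z : tends (fun _ => RtoC 0) 1).
{ revert T; apply null_ext; intros n.
  destruct (Ceq_dec (qpoch_inf (x * q ^ n) q) 0) as [->|D]; [reflexivity |].
  exfalso; rewrite (qpoch_inf_split x q n Hq) in E.
  revert E; now apply Cmult_neq_0. }
assert (H := tends_unique _ _ _ (tends_const 0) Z).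
apply (f_equal Re) in H; simpl in H; lra.
Qed.

(** [1 / (x)_k] equals [(x q^k)_oo / (x)_oo], and the tails are bounded. *)
Lemma inv_qpoch_bounded (x q : C) : (Cmod q < 1)%R ->
  (forall k, qpoch x q k <> 0) ->
  exists K, forall k, (Cmod (/ qpoch x q k) <= K)%R.
Proof.
intros Hq Hx; pose proof (qpoch_inf_neq0 x q Hq Hx) as N.
destruct (tends_bounded _ _ (tends_qpoch_inf_tail x q Hq)) as [K HK].
exists (Cmod (/ qpoch_inf x q) * K)%R; intros k.
replace (/ qpoch x q k) with (/ qpoch_inf x q * qpoch_inf (x * q ^ k) q).
- rewrite Cmod_mult; apply Rmult_le_compat_l; [apply Cmod_ge_0 | apply HK].
- rewrite (qpoch_inf_split x q k Hq) in N |- *; field; split; [apply Hx |].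
  intros E; apply N; rewrite E; ring.
Qed.

(** * Weighted sums and summation by parts *)

(* For c = a w the weight is (c; q)_oo (a; q)_k / (c; q)_k, in a form that makes
   sense when (c; q)_k vanishes. *)
Definition wsum (a q w : C) (f : nat -> C) (M : nat) : C :=
  sum_n (fun k => f k * (qpoch a q k * qpoch_inf (a * w * q ^ k) q)) M.

(** Abel summation: with weights [W_k = (a)_k (a w q^k)_oo], the difference [W_k - w W_(k+1)] is
    [(1 - w) (a)_k (a w q^(k+1))_oo], since [(1 - a w q^k) - w (1 - a q^k) = 1 - w]. *)
Lemma wsum_mul_lin (a q w : C) (f : nat -> C) (M : nat) : (Cmod q < 1)%R ->
  wsum a q w (mul_lin w f) M
  = (1 - w) * wsum a q (w * q) f M
    + w * f M * (qpoch a q (S M) * qpoch_inf (a * w * q ^ S M) q).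
Proof.
intros Hq; unfold wsum.
assert (P : forall k, qpoch_inf (a * w * q ^ k) q
  = (1 - a * w * q ^ k) * qpoch_inf (a * w * q ^ S k) q).
{ intros k; rewrite (qpoch_inf_split _ q 1 Hq).
  replace (a * w * q ^ k * q ^ 1) with (a * w * q ^ S k) by (simpl; ring).
  simpl; ring. }
assert (Q : forall k, qpoch_inf (a * (w * q) * q ^ k) q = qpoch_inf (a * w * q ^ S k) q)
  by (intros k; f_equal; simpl; ring).
induction M as [|M IH].
- rewrite !sum_O, Q, P; simpl; ring.
- rewrite !sum_Sn, IH, Q; change plus with Cplus.
  rewrite (P (S M)); simpl; ring.
Qed.

Lemma conv_qbin_peel (q w : C) (u : nat -> C) : (Cmod q < 1)%R ->
  conv (qbin q w 0) u = mul_lin w (conv (qbin q (w * q) 0) u).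
Proof. intros Hq; now rewrite qbin_peel, mul_lin_conv. Qed.

Lemma wsum_peel (a q w : C) (u : nat -> C) (l M : nat) : (Cmod q < 1)%R ->
  let U i := conv (qbin q (w * q ^ i) 0) u in
  wsum a q (w * q ^ l) (U l) M
  = (1 - w * q ^ l) * wsum a q (w * q ^ S l) (U (S l)) M
    + w * q ^ l * U (S l) M * (qpoch a q (S M) * qpoch_inf (a * w * q ^ (l + S M)) q).
Proof.
intros Hq U; unfold U.
rewrite conv_qbin_peel, wsum_mul_lin by exact Hq.
replace (w * q ^ l * q) with (w * q ^ S l) by (simpl; ring).
replace (a * (w * q ^ l) * q ^ S M) with (a * w * q ^ (l + S M))
  by (rewrite Cpow_add_r; ring).
reflexivity.
Qed.

Lemma weight_bounded (a q x : C) : (Cmod q < 1)%R ->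
  exists K, forall m n, (Cmod (qpoch a q m * qpoch_inf (x * q ^ n) q) <= K)%R.
Proof.
intros Hq.
destruct (tends_bounded _ _ (tends_qpoch a q Hq)) as [K1 H1].
destruct (tends_bounded _ _ (tends_qpoch_inf_tail x q Hq)) as [K2 H2].
exists (K1 * K2)%R; intros m n; rewrite Cmod_mult.
apply Rmult_le_compat; try apply Cmod_ge_0; [apply H1 | apply H2].
Qed.

(** Nullity of the last series passes to the earlier ones, each being a linear factor times the
    next. As the weights are bounded, all [l] boundary terms vanish in the limit. *)
Lemma wsum_peel_null (a q w : C) (u : nat -> C) (l : nat) : (Cmod q < 1)%R ->
  null (conv (qbin q (w * q ^ l) 0) u) ->
  null (fun M => wsum a q w (conv (qbin q w 0) u) M
    - qpoch w q l * wsum a q (w * q ^ l) (conv (qbin q (w * q ^ l) 0) u) M).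
Proof.
intros Hq; induction l as [|l IH]; intros Hl.
- apply (null_ext (fun _ => 0)).
  + intros M; simpl; rewrite Cmult_1_r; ring.
  + apply (null_le _ (fun _ => 0%R)); [| apply is_lim_seq_const].
    intros _; rewrite Cmod_0; apply Rle_refl.
- destruct (weight_bounded a q (a * w) Hq) as [K HK].
  assert (Hl' : null (conv (qbin q (w * q ^ l) 0) u)).
  { rewrite conv_qbin_peel by exact Hq.
    replace (w * q ^ l * q) with (w * q ^ S l) by (simpl; ring).
    now apply null_mul_lin. }
  apply (null_ext (fun M =>
    (wsum a q w (conv (qbin q w 0) u) M
     - qpoch w q l * wsum a q (w * q ^ l) (conv (qbin q (w * q ^ l) 0) u) M)
    + qpoch w q l * (w * q ^ l) *
      (qpoch a q (S M) * qpoch_inf (a * w * q ^ (l + S M)) q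
       * conv (qbin q (w * q ^ S l) 0) u M))).
  + intros M; rewrite (wsum_peel a q w u l M Hq).
    change (qpoch w q (S l)) with (qpoch w q l * (1 - w * q ^ l)); ring.
  + apply null_plus; [now apply IH |].
    apply null_scal, (null_bounded_mult K); [| exact Hl].
    intros M; apply HK.
Qed.

(** Dilation by [q^N] with growing [N] leaves only the constant term. *)
Lemma tends_pow_0 (q : C) (f : nat -> C) (k : nat) : (Cmod q < 1)%R ->
  tends (fun N => (q ^ N) ^ k * f k) (f O * delta k).
Proof.
intros Hq; destruct k as [|k].
- apply (null_ext (fun N => f O - f O)); [intros; simpl; ring | apply tends_const].
- apply (null_le _ (fun N => (Cmod (f (S k)) * Cmod q ^ N)%R)).
  + intros N; simpl delta.
    replace ((q ^ N) ^ S k * f (S k) - f O * 0) with (f (S k) * (q ^ N) ^ S k) by ring.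
    rewrite Cmod_mult; apply Rmult_le_compat_l; [apply Cmod_ge_0 |].
    rewrite <- Cpow_mult_r, Nat.mul_succ_r, Cpow_add_r, Cmod_mult, !Cmod_pow.
    pose proof (Cmod_ge_0 q).
    rewrite <- (Rmult_1_l (Cmod q ^ N)) at 2.
    apply Rmult_le_compat_r; [now apply pow_le |].
    rewrite <- (pow1 (N * k)); apply pow_incr; lra.
  + apply lim0_scal, lim0_geom; split; [apply Cmod_ge_0 | exact Hq].
Qed.

Lemma tends_conv (F : nat -> nat -> C) (f u : nat -> C) (n : nat) :
  (forall k, tends (fun N => F N k) (f k)) ->
  tends (fun N => conv (F N) u n) (conv f u n).
Proof.
intros H; rewrite <- conv_sum.
apply (null_ext (fun N => sum_n (fun k => F N k * u (n - k)%nat) n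
   - sum_n (fun k => f k * u (n - k)%nat) n)).
- intros N; now rewrite (conv_sum (F N)).
- apply (tends_sum (fun N k => F N k * u (n - k)%nat)); intros k.
  apply tends_mult; [apply H | apply tends_const].
Qed.

(** For fixed [M], both the series [(w q^N X)_oo], coefficientwise, and the tails in the weights
    tend to 1. *)
Lemma wsum_dilate_tends (a q w : C) (u : nat -> C) (M : nat) : (Cmod q < 1)%R ->
  tends (fun N => wsum a q (w * q ^ N) (conv (qbin q (w * q ^ N) 0) u) M)
    (sum_n (fun k => u k * qpoch a q k) M).
Proof.
intros Hq.
apply (tends_sum (fun N k => conv (qbin q (w * q ^ N) 0) u k *
  (qpoch a q k * qpoch_inf (a * (w * q ^ N) * q ^ k) q))).
intros k; apply tends_mult.
- replace (u k) with (conv delta u k) by now rewrite conv_delta_l.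
  apply (tends_conv (fun N => qbin q (w * q ^ N) 0)); intros j.
  assert (H := tends_pow_0 q (qbin q w 0) j Hq).
  change (qbin q w 0 O) with (RtoC 1) in H; rewrite Cmult_1_l in H.
  revert H; apply null_ext; intros N; now rewrite qbin_scale.
- refine (eq_ind _ (tends _) _ _ (Cmult_1_r (qpoch a q k))).
  apply tends_mult; [apply tends_const |].
  apply (null_ext (fun N => qpoch_inf (a * w * q ^ k * q ^ N) q - 1)).
  + intros N; do 2 f_equal; ring.
  + now apply tends_qpoch_inf_tail.
Qed.

(** Infinitely many peelings are needed, so the boundary terms must be controlled uniformly in their
    number [N] before [M] grows. *)
Lemma wsum_qbin_null (a q w : C) (u : nat -> C) : (Cmod q < 1)%R -> null u ->
  null (fun M => wsum a q w (conv (qbin q w 0) u) M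
    - qpoch_inf w q * sum_n (fun k => u k * qpoch a q k) M).
Proof.
intros Hq Hu; pose proof (Cmod_ge_0 q) as Hq0.
(* [(w X)_oo] is entire, so any ratio in [(0, 1)] would do. *)
destruct (qbin_geometric q w 0 (1 / 2) Hq) as [K0 H0]; [lra | rewrite Cmod_0; lra |].
destruct (weight_bounded a q (a * w) Hq) as [K1 H1].
destruct (tends_bounded _ _ (tends_qpoch w q Hq)) as [K2 H2].
set (g := geom_conv (1 / 2) u).
assert (Hg : forall l M, (Cmod (conv (qbin q (w * q ^ l) 0) u M) <= K0 * g M)%R).
{ intros l; apply geom_conv_bound; intros n.
  apply Rle_trans with (2 := H0 n).
  rewrite qbin_scale, Cmod_mult, !Cmod_pow.
  rewrite <- (Rmult_1_l (Cmod (qbin q w 0 n))) at 2.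
  apply Rmult_le_compat_r; [apply Cmod_ge_0 |].
  rewrite <- (pow1 n); apply pow_incr; split; [now apply pow_le |].
  rewrite <- (pow1 l); apply pow_incr; lra. }
(* The boundary term of peeling [N] is at most [K2 |w| |q|^N K1 K0 g M]; summing the geometric
   series in [|q|] gives [K] and the factor [1 - |q|^N] below. *)
set (K := (K2 * Cmod w * K1 * K0 / (1 - Cmod q))%R).
assert (B : forall M N, (Cmod (wsum a q w (conv (qbin q w 0) u) M
    - qpoch w q N * wsum a q (w * q ^ N) (conv (qbin q (w * q ^ N) 0) u) M)
    <= K * g M * (1 - Cmod q ^ N))%R).
{ intros M; induction N as [|N IH].
  - simpl; rewrite Cmult_1_r, Cmult_1_l.
    replace (_ - _) with (RtoC 0) by ring.
    rewrite Cmod_0; lra.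
  - match goal with |- (Cmod ?x <= _)%R =>
      replace x with
      ((wsum a q w (conv (qbin q w 0) u) M
        - qpoch w q N * wsum a q (w * q ^ N) (conv (qbin q (w * q ^ N) 0) u) M)
       + qpoch w q N * w * q ^ N * (qpoch a q (S M) * qpoch_inf (a * w * q ^ (N + S M)) q)
         * conv (qbin q (w * q ^ S N) 0) u M) end.
    2:{ rewrite (wsum_peel a q w u N M Hq).
        change (qpoch w q (S N)) with (qpoch w q N * (1 - w * q ^ N)); ring. }
    apply Rle_trans with (1 := Cmod_triangle _ _).
    replace (K * g M * (1 - Cmod q ^ S N))%R with
      (K * g M * (1 - Cmod q ^ N) + K2 * Cmod w * Cmod q ^ N * K1 * (K0 * g M))%R
      by (unfold K; simpl; field; lra).
    apply Rplus_le_compat; [exact IH |].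
    rewrite (Cmod_mult _ (conv _ _ _)), (Cmod_mult _ (qpoch a q (S M) * _)).
    rewrite (Cmod_mult _ (q ^ N)), (Cmod_mult _ w), Cmod_pow.
    assert (P : (0 <= Cmod q ^ N)%R) by now apply pow_le.
    repeat (apply Rmult_le_compat; repeat apply Rmult_le_pos;
      try apply Cmod_ge_0; try exact P; try apply Rle_refl).
    + apply H2.
    + apply H1.
    + apply Hg. }
(* Letting [N] tend to infinity at fixed [M] leaves a bound by [g M], which is null. *)
apply (null_le _ (fun M => (Rabs K * g M)%R)).
- intros M.
  assert (Hg0 : (0 <= g M)%R).
  { unfold g; clear; induction M as [|M IH]; simpl; [apply Cmod_ge_0 |].
    pose proof (Cmod_ge_0 (u (S M))); lra. }
  apply (Cmod_le_of_tends (fun N => wsum a q w (conv (qbin q w 0) u) M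
    - qpoch w q N * wsum a q (w * q ^ N) (conv (qbin q (w * q ^ N) 0) u) M)).
  + intros N; apply Rle_trans with (1 := B M N).
    assert (P : (0 <= Cmod q ^ N <= 1)%R).
    { split; [now apply pow_le |]; rewrite <- (pow1 N); apply pow_incr; lra. }
    apply Rle_trans with (Rabs K * g M * (1 - Cmod q ^ N))%R.
    * apply Rmult_le_compat_r; [lra |]; apply Rmult_le_compat_r; [exact Hg0 | apply Rle_abs].
    * rewrite <- (Rmult_1_r (Rabs K * g M)) at 2; apply Rmult_le_compat_l; [| lra].
      apply Rmult_le_pos; [apply Rabs_pos | exact Hg0].
  + apply (null_ext (fun N => (-1) *
      (qpoch w q N * wsum a q (w * q ^ N) (conv (qbin q (w * q ^ N) 0) u) M
       - qpoch_inf w q * sum_n (fun k => u k * qpoch a q k) M))); [intros; ring |].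
    apply null_scal, tends_mult; [now apply tends_qpoch | now apply wsum_dilate_tends].
- apply lim0_scal, geom_conv_lim; [lra | exact Hu].
Qed.

(** * Coprime factors and the comparison of two weighted sums *)

(* With E_w = (w X; q)_oo, the products Y i j = E_(x q^i) E_(y q^j) u are null when
   i = 0 or j = 0, and (1 - x q^i X) Y (i+1) (j+1) = Y i (j+1),
   (1 - y q^j X) Y (i+1) (j+1) = Y (i+1) j are multiples by coprime factors. *)
Lemma null_of_coprime (q x y : C) (u : nat -> C) : (Cmod q < 1)%R ->
  (forall l, x <> y * q ^ l) -> (forall l, y <> x * q ^ l) ->
  null (conv (qbin q x 0) u) -> null (conv (qbin q y 0) u) -> null u.
Proof.
intros Hq Hxy Hyx Hx Hy; pose proof (Cmod_ge_0 q) as Hq0.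
assert (small : forall v, exists N, (Cmod (v * q ^ N) < 1)%R).
{ intros v; assert (G := lim0_scal (Cmod v) _ (lim0_geom (Cmod q) (conj Hq0 Hq))).
  apply is_lim_seq_spec in G; destruct (G (mkposreal 1 Rlt_0_1)) as [N HN].
  exists N; specialize (HN N (Nat.le_refl N)); apply Rabs_def2 in HN; simpl in HN.
  rewrite Cmod_mult, Cmod_pow; lra. }
(* For [|v| < 1] the coefficients of [1 / (v X)_oo] decay geometrically, so convolving with them
   preserves nullity. *)
assert (cancel : forall v, (Cmod v < 1)%R -> forall f, null (conv (qbin q v 0) f) -> null f).
{ intros v Hv f Hf; rewrite <- (conv_delta_l f), <- (qbin_diag q 0 Hq).
  rewrite <- (qbin_conv q 0 v 0), conv_assoc by exact Hq.
  now apply null_conv_qbin. }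
set (Y i j := conv (qbin q (x * q ^ i) 0) (conv (qbin q (y * q ^ j) 0) u)).
assert (Y_x : forall i j, Y i j = mul_lin (x * q ^ i) (Y (S i) j)).
{ intros i j; unfold Y; rewrite conv_qbin_peel by exact Hq.
  do 3 f_equal; simpl; ring. }
assert (Y_y : forall i j, Y i j = mul_lin (y * q ^ j) (Y i (S j))).
{ intros i j; unfold Y.
  rewrite (conv_qbin_peel q (y * q ^ j)), conv_comm, <- mul_lin_conv, conv_comm by exact Hq.
  replace (y * q ^ j * q) with (y * q ^ S j) by (simpl; ring); reflexivity. }
assert (Y_0j : forall j, null (Y O j)).
{ intros j; unfold Y; simpl; rewrite Cmult_1_r.
  rewrite <- conv_assoc, (conv_comm (qbin q x 0)), conv_assoc.
  apply null_conv_qbin; [exact Hq | rewrite Cmod_0; lra | exact Hx]. }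
assert (Y_i0 : forall i, null (Y i O)).
{ intros i; unfold Y; simpl; rewrite Cmult_1_r.
  apply null_conv_qbin; [exact Hq | rewrite Cmod_0; lra | exact Hy]. }
assert (Y_null : forall i j, null (Y i j)).
{ induction i as [|i IHi]; [exact Y_0j |].
  induction j as [|j IHj]; [apply Y_i0 |].
  assert (H1 := IHi (S j)); rewrite Y_x in H1.
  rewrite Y_y in IHj.
  destruct (Rlt_dec (Cmod (x * q ^ i)) 1) as [L|L];
    [now apply (null_mul_lin_small (x * q ^ i)) |].
  apply (null_mul_lin_two (x * q ^ i) (y * q ^ j)); [| exact H1 | exact IHj].
  (* Equal factors are nonzero here, having modulus at least 1; dividing by the smaller power of [q]
     would make one of [x], [y] a power of [q] times the other. *)
  intros E.
  assert (Nx : x * q ^ i <> 0) by (intros E0; rewrite E0, Cmod_0 in L; lra).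
  destruct (Nat.le_ge_cases i j) as [D|D].
  - assert (Nq : q ^ i <> 0) by (intros E0; apply Nx; rewrite E0; ring).
    apply (Hxy (j - i)%nat).
    replace j with (j - i + i)%nat in E by lia; rewrite Cpow_add_r, Cmult_assoc in E.
    replace x with (x * q ^ i / q ^ i) by (field; exact Nq).
    rewrite E; field; exact Nq.
  - assert (Nq : q ^ j <> 0) by (intros E0; apply Nx; rewrite E, E0; ring).
    apply (Hyx (i - j)%nat).
    replace i with (i - j + j)%nat in E by lia; rewrite Cpow_add_r, Cmult_assoc in E.
    replace y with (y * q ^ j / q ^ j) by (field; exact Nq).
    rewrite <- E; field; exact Nq. }
destruct (small x) as [i Hi]; destruct (small y) as [j Hj].
apply (cancel _ Hj), (cancel _ Hi), Y_null.
Qed.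

Lemma wsum_balance (a q x y : C) (u : nat -> C) : (Cmod q < 1)%R ->
  null (conv (qbin q x 0) u) -> null (conv (qbin q y 0) u) ->
  null (fun M => qpoch_inf y q * wsum a q x (conv (qbin q x 0) u) M
    - qpoch_inf x q * wsum a q y (conv (qbin q y 0) u) M).
Proof.
intros Hq Hx Hy.
assert (shift : forall v w l, null (conv (qbin q w 0) u) -> w = v * q ^ l ->
  null (fun M => qpoch_inf w q * wsum a q v (conv (qbin q v 0) u) M
    - qpoch_inf v q * wsum a q w (conv (qbin q w 0) u) M)).
{ intros v w l Hw ->.
  apply (null_ext (fun M => qpoch_inf (v * q ^ l) q *
    (wsum a q v (conv (qbin q v 0) u) M
     - qpoch v q l * wsum a q (v * q ^ l) (conv (qbin q (v * q ^ l) 0) u) M))).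
  - intros M; rewrite (qpoch_inf_split v q l Hq); ring.
  - now apply null_scal, wsum_peel_null. }
destruct (classic (exists l, x = y * q ^ l)) as [[l E]|Nx].
{ apply (null_ext (fun M => (-1) *
    (qpoch_inf x q * wsum a q y (conv (qbin q y 0) u) M
     - qpoch_inf y q * wsum a q x (conv (qbin q x 0) u) M))); [intros; ring |].
  now apply null_scal, (shift y x l). }
destruct (classic (exists l, y = x * q ^ l)) as [[l E]|Ny]; [now apply (shift x y l) |].
(* In the coprime case both weighted sums are compared with the partial sums of [u_k (a)_k]. *)
assert (Hu : null u).
{ apply (null_of_coprime q x y); try assumption; intros l E;
    [apply Nx | apply Ny]; now exists l. }
apply (null_ext (fun M =>
  qpoch_inf y q * (wsum a q x (conv (qbin q x 0) u) M
    - qpoch_inf x q * sum_n (fun k => u k * qpoch a q k) M)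
  - qpoch_inf x q * (wsum a q y (conv (qbin q y 0) u) M
    - qpoch_inf y q * sum_n (fun k => u k * qpoch a q k) M))); [intros; ring |].
apply null_minus; apply null_scal; now apply wsum_qbin_null.
Qed.

(** * The q-binomial coefficients in closed form and the summation formula *)

Lemma qbin_eq_qpoch (q b z : C) (n : nat) : (Cmod q < 1)%R ->
  qbin q (b * z) z n = qpoch b q n / qpoch q q n * z ^ n.
Proof.
intros Hq; induction n as [|n IH]; [simpl; field; apply C1_nz |].
assert (Nq : forall k, qpoch q q k <> 0).
{ induction k as [|k IHk]; simpl; [apply C1_nz |].
  apply Cmult_neq_0; [exact IHk | exact (one_minus_qpow_neq0 q k Hq)]. }
change (qbin q (b * z) z n * ((z - b * z * q ^ n) / (1 - q ^ S n))
  = qpoch b q n * (1 - b * q ^ n) / (qpoch q q n * (1 - q ^ S n)) * (z * z ^ n)).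
rewrite IH; field; split; [apply one_minus_qpow_neq0, Hq | apply Nq].
Qed.

Theorem theorem5 :
  forall (q a b c : C) (g : nat -> C),
  (Cmod q < 1)%R ->
  a <> 0 -> b <> 0 ->
  (forall m : nat, qpoch c q m <> 0) ->
  (forall n : nat, qpoch q q n <> 0) ->
  (forall k : nat, qpoch a q k <> 0) ->
  qpoch_inf c q <> 0 ->
  qpoch_inf (c / (a * b)) q <> 0 ->
  forall S G : C,
  is_triangular_series (qterm a b c q g) S ->
  is_series g G ->
  S = (qpoch_inf (c / a) q * qpoch_inf (c / b) q)
      / (qpoch_inf c q * qpoch_inf (c / (a * b)) q) * G.
Proof.
intros q a b c g Hq Ha Hb Hc Hqq Haq Hci Hzi S G HS HG.
set (z := c / (a * b)) in *.
set (h := fun k => g k * (qpoch (c / b) q k / qpoch a q k)).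
(* [qbin q 0 z] is the series of [1 / (z X)_oo], so [u] is the formal quotient U. *)
set (u := conv (qbin q 0 z) h).
set (F := conv (qbin q (c / a) 0) u).
assert (EB : c / a = b * z) by (unfold z; field; auto).
assert (EH : conv (qbin q z 0) u = h).
{ unfold u; now rewrite <- conv_assoc, qbin_conv, qbin_diag, conv_delta_l. }
assert (EF : F = conv (qbin q (c / a) z) h).
{ unfold F, u; now rewrite <- conv_assoc, qbin_conv. }
assert (ES : forall m, sum_n (fun n => qterm a b c q g m n) m
  = qpoch a q m / qpoch c q m * F m).
{ intros m; rewrite EF, <- conv_sum.
  transitivity (sum_n (fun n => scal (qpoch a q m / qpoch c q m)
     (qbin q (c / a) z n * h (m - n)%nat)) m).
  - apply sum_n_ext; intros n; change scal with Cmult.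
    rewrite EB, qbin_eq_qpoch by exact Hq; unfold qterm, h; fold z.
    match goal with |- ?x = ?y => change (@eq C x y) end.
    field; auto.
  - apply (sum_n_scal_l (V := C_NormedModule)). }
(* [F m] is [(c)_m / (a)_m], a bounded factor, times the general term of a convergent series. *)
assert (HF : null F).
{ destruct (inv_qpoch_bounded a q Hq Haq) as [K1 H1].
  destruct (tends_bounded _ _ (tends_qpoch c q Hq)) as [K2 H2].
  apply (null_ext (fun m => / qpoch a q m * (qpoch c q m *
     sum_n (fun n => qterm a b c q g m n) m))).
  - intros m; rewrite ES; field; auto.
  - apply (null_bounded_mult K1 _ _ H1), (null_bounded_mult K2 _ _ H2).
    exact (null_of_is_series _ _ HS). }
assert (Hh : null h).
{ destruct (inv_qpoch_bounded a q Hq Haq) as [K1 H1].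
  destruct (tends_bounded _ _ (tends_qpoch (c / b) q Hq)) as [K2 H2].
  apply (null_ext (fun k => / qpoch a q k * (qpoch (c / b) q k * g k))).
  - intros k; unfold h, Cdiv; ring.
  - apply (null_bounded_mult K1 _ _ H1), (null_bounded_mult K2 _ _ H2).
    exact (null_of_is_series _ _ HG). }
assert (WF : forall M, wsum a q (c / a) F M
  = qpoch_inf c q * sum_n (fun m => sum_n (fun n => qterm a b c q g m n) m) M).
{ intros M; rewrite <- (sum_n_scal_l (V := C_NormedModule) (qpoch_inf c q)).
  apply sum_n_ext; intros m; change scal with Cmult; rewrite ES.
  (* Splitting [(c)_oo] at [m] turns the weight into [(c)_oo (a)_m / (c)_m]. *)
  replace (a * (c / a) * q ^ m) with (c * q ^ m) by (field; exact Ha).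
  rewrite (qpoch_inf_split c q m Hq).
  match goal with |- ?x = ?y => change (@eq C x y) end; field; apply Hc. }
assert (WH : forall M, wsum a q z h M = qpoch_inf (c / b) q * sum_n g M).
{ intros M; rewrite <- (sum_n_scal_l (V := C_NormedModule) (qpoch_inf (c / b) q)).
  apply sum_n_ext; intros k; change scal with Cmult; unfold h.
  (* The factor [(c/b)_k] inside [h k] completes the tail to [(c/b)_oo], without any division by
     [(c/b)_k], which may vanish. *)
  replace (a * z * q ^ k) with (c / b * q ^ k) by (unfold z; field; auto).
  rewrite (qpoch_inf_split (c / b) q k Hq).
  match goal with |- ?x = ?y => change (@eq C x y) end; field; apply Haq. }
assert (Bal := wsum_balance a q (c / a) z u Hq HF ltac:(rewrite EH; exact Hh)).
fold F in Bal; rewrite EH in Bal.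
assert (E : qpoch_inf z q * (qpoch_inf c q * S)
  = qpoch_inf (c / a) q * (qpoch_inf (c / b) q * G)).
{ apply (tends_unique (fun M => qpoch_inf z q * wsum a q (c / a) F M)).
  - apply (null_ext (fun M => qpoch_inf z q * (qpoch_inf c q *
      sum_n (fun m => sum_n (fun n => qterm a b c q g m n) m) M)
      - qpoch_inf z q * (qpoch_inf c q * S))); [intros; now rewrite WF |].
    repeat (apply tends_mult; [apply tends_const |]).
    exact (tends_of_is_series _ _ HS).
  - apply (null_ext (fun M =>
      (qpoch_inf z q * wsum a q (c / a) F M - qpoch_inf (c / a) q * wsum a q z h M)
      + qpoch_inf (c / a) q * (qpoch_inf (c / b) q * (sum_n g M - G)))).
    + intros M; rewrite WH; ring.
    + apply null_plus; [exact Bal |]; apply null_scal, null_scal.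
      exact (tends_of_is_series _ _ HG). }
replace S with (qpoch_inf z q * (qpoch_inf c q * S) / (qpoch_inf c q * qpoch_inf z q))
  by (field; auto).
rewrite E; field; auto.
Qed.
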